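(* Let $S=\mathrm{diag}(S_a,S_b)\in\mathbb{R}^{q\times q}$, with $S_a\in\mathbb{R}^{r\times r}$, $S_b\in\mathbb{R}^{n_w\times n_w}$, $q=r+n_w$, and suppose that all the eigenvalues of $S$ are distinct with zero real parts. Let $v(t)\in\mathbb{R}^q$ be a solution of the leader system $\dot v=Sv$. Let $\bar{\mathcal{G}}_{\sigma(t)}$ be a switching digraph on the nodes $\{0,1,\dots,N\}$ with weighted adjacency matrix $[\bar a_{ij}(t)]_{i,j=0}^{N}$ and switching instants $t_0=0<t_1<t_2<\cdots$. Assume that there exists a subsequence $\{i_k\}$ of $\{i: i=0,1,\dots\}$ with $t_{i_{k+1}}-t_{i_k}<\epsilon$ for some positive $\epsilon$ such that every union graph $\bigcup_{j=i_k}^{i_{k+1}-1}\bar{\mathcal{G}}_{\sigma(t_j)}$ contains a directed spanning tree with node $0$ as the root. Consider the adaptive distributed observer, for $i=1,\dots,N$, $$\dot{\hat S}_i=\mu_1\sum_{j=0}^{N}\bar a_{ij}(t)(\hat S_j-\hat S_i),\qquad \dot{\hat v}_i=\hat S_i\hat v_i+\mu_2\sum_{j=0}^{N}\bar a_{ij}(t)(\hat v_j-\hat v_i),$$ where $\hat S_0=S$, $\hat v_0=v$, $\hat S_i(t)\in\mathbb{R}^{q\times q}$, $\hat v_i(t)\in\mathbb{R}^q$. Put $\tilde S_i=\hat S_i-S$, $\tilde v_i=\hat v_i-v$, $\tilde S=\mathrm{col}(\tilde S_1,\dots,\tilde S_N)$ and $\tilde v=\mathrm{col}(\tilde v_1,\dots,\tilde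 v_N)$. Then, for any initial conditions $\tilde S(0)$ and $\tilde v(0)$ and any $\mu_1,\mu_2>0$: 1. $\lim_{t\to+\infty}\tilde S(t)=0$ exponentially; 2. $\lim_{t\to+\infty}\tilde v(t)=0$ exponentially.
   Context: $\mathrm{col}(a_1,\dots,a_s)=[a_1^T,\dots,a_s^T]^T$ denotes vertical stacking (for $\tilde S$, the matrices $\tilde S_i$ are stacked vertically). Switching signal: $\sigma:[0,+\infty)\to\mathcal{P}=\{1,\dots,n_0\}$ ($n_0$ a positive integer) is piecewise constant, constant on each $[t_i,t_{i+1})$, and its switching instants $t_0=0<t_1<t_2<\cdots$ satisfy $t_{i+1}-t_i\ge\tau_0>0$ for all $i\ge0$ and some constant $\tau_0$ (the dwell time). Switching digraph: for each $p\in\mathcal{P}$ there is a digraph $\bar{\mathcal{G}}_p=(\bar{\mathcal{V}},\bar{\mathcal{E}}_p)$ with $\bar{\mathcal{V}}=\{0,1,\dots,N\}$ and a fixed weighted adjacency matrix $\bar{\mathcal{A}}_p\in\mathbb{R}^{(N+1)\times(N+1)}$, which is nonnegative with zero diagonal and whose $(i,j)$ entry is positive if and only if $(j,i)\in\bar{\mathcal{E}}_p$, where $(j,i)$ denotes an edge from node $j$ to node $i$. Here $\bar{\mathcal{G}}_{\sigma(t)}$ is the digraph active at time $t$, and $\bar{\mathcal{A}}_{\sigma(t)}=[\bar a_{ij}(t)]$, $i,j=0,\dots,N$. The subgraph on nodes $1,\dots,N$ is not assumed undirected. The union of digraphs on the same node set is the digraph with the union of the edge sets. A directed spanning tree with root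 $0$ is a subgraph containing all nodes in which every node except $0$ has exactly one parent, $0$ has no parent, and every node other than $0$ is reachable from $0$ by a directed path. Solutions are continuous functions of time satisfying the differential equations on each interval $[t_i,t_{i+1})$. A function $x(t)$ converges to $0$ exponentially if there are constants $\alpha,\lambda>0$ (possibly depending on the initial conditions) such that $\|x(t)\|\le\alpha e^{-\lambda t}$ for all $t\ge0$. *)

(* Defs.v *)
From mathcomp Require Import all_boot all_order all_algebra.
From mathcomp Require Import all_classical all_reals all_analysis.
From mathcomp Require Import complex.
Import Order.TTheory GRing.Theory Num.Theory.
Import numFieldNormedType.Exports.

Set Implicit Arguments.
Unset Strict Implicit.
Unset Printing Implicit Defensive.

Local Open Scope classical_set_scope.
Local Open Scope ring_scope.

(* [lambda] lists the complex eigenvalues of the real matrix [S], repeated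
   according to their algebraic multiplicity. *)
Definition eigenvalue_list (R : realType) (q : nat) (S : 'M[R]_q)
    (lambda : seq R[i]) : Prop :=
  char_poly (map_mx (real_complex R) S) = \prod_(z <- lambda) ('X - z%:P).

Definition distinct_imaginary_eigenvalues (R : realType) (q : nat)
    (S : 'M[R]_q) : Prop :=
  exists lambda : seq R[i],
    [/\ eigenvalue_list S lambda, uniq lambda
      & forall z, z \in lambda -> complex.Re z = 0].

(* Only the times [t >= 0] matter, although signals and trajectories are
   total functions on [R]. *)
Definition switching_instants (R : realType) (t_ : nat -> R) : Prop :=
  t_ 0%N = 0 /\ exists tau0 : R, 0 < tau0 /\ forall i, tau0 <= t_ i.+1 - t_ i.

Definition switching_signal (R : realType) (n0 : nat) (t_ : nat -> R)
    (sigma : R -> 'I_n0) : Prop :=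
  forall i t, t_ i <= t < t_ i.+1 -> sigma t = sigma (t_ i).

(* A digraph is given by its edge relation: [E j i] is an edge from [j] to
   [i], hence the transposed indices with respect to the adjacency matrix. *)
Definition weighted_adjacency (R : realType) (n : nat) (E : rel 'I_n)
    (A : 'M[R]_n) : Prop :=
  [/\ forall i j, 0 <= A i j, forall i, A i i = 0
    & forall i j, 0 < A i j <-> E j i].

Definition has_spanning_tree (V : finType) (E : rel V) (root : V) : Prop :=
  exists T : rel V,
    [/\ subrel T E,
        forall j, ~~ T j root,
        forall i, i != root -> exists! j, T j i
      & forall i, i != root -> connect T root i].

(* Union of the digraphs [E (sigma (t_ l))] for [m <= l <= n - 1]. *)
Definition union_graph (R : realType) (n0 : nat) (V : finType)
    (E : 'I_n0 -> rel V) (sigma : R -> 'I_n0) (t_ : nat -> R) (m n : nat) :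
    rel V :=
  fun a b => has (fun l => E (sigma (t_ l)) a b) (index_iota m n).

(* Derivative at [t] of the restriction of [x] to [D]: two-sided at interior
   points of [D], right derivative at a left endpoint belonging to [D]. *)
Definition has_derivative_within (R : realType) (V : normedModType R)
    (D : set R) (x : R -> V) (t : R) (y : V) : Prop :=
  (s - t)^-1 *: (x s - x t) @[s --> within D t^'] --> y.

(* [x] is continuous on [0, +oo[ and satisfies x' = f on each
   [t_ i, t_ i.+1[, where [f t] is the right-hand side of the differential
   equation evaluated along the trajectories at time [t]. *)
Definition piecewise_solution (R : realType) (V : normedModType R)
    (t_ : nat -> R) (x f : R -> V) : Prop :=
  {within `[0, +oo[, continuous x} /\
  forall i t, t_ i <= t < t_ i.+1 ->
    has_derivative_within `[t_ i, t_ i.+1[ x t (f t).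

(* For matrices, [`| _ |] is the largest absolute value of the entries; since
   all norms on a finite-dimensional space are equivalent and [alpha] is
   existentially quantified, this choice of norm is immaterial. *)
Definition converges_to0_exponentially (R : realType) (V : normedModType R)
    (x : R -> V) : Prop :=
  exists alpha lambda : R,
    [/\ 0 < alpha, 0 < lambda
      & forall t, 0 <= t -> `|x t| <= alpha * expR (- lambda * t)].

(* Main.v *)
Require Import Defs.
From mathcomp Require Import all_boot all_order all_algebra.
From mathcomp Require Import all_classical all_reals all_analysis.
From mathcomp Require Import complex zify ring lra.
Import Order.TTheory GRing.Theory Num.Theory.
Import numFieldNormedType.Exports.

Set Implicit Arguments.
Unset Strict Implicit.
Unset Printing Implicit Defensive.

Local Open Scope classical_set_scope.
Local Open Scope ring_scope.

(* In suitable coordinates both error systems become scalar consensus equations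
   x_i' = mu sum_j a_ij (x_j - x_i) + d_i with leader x_0 = 0.  For the matrix
   errors the coordinates are the entries, and d = 0.  For the vector errors,
   write the real and imaginary parts of the components along the left
   eigenvectors of S in the frame rotating with e^(St): the drift S disappears,
   everything stays bounded in both directions because the eigenvalues are
   distinct and imaginary, and the disturbance satisfies
   |d| <= beta e^(-lambda t) (1 + max |x|) by the decay of the matrix errors.

   Such a system is bounded by comparison with a scalar equation of integrable
   rate, so d decays exponentially.  Adding a multiple of e^(-lambda t) to every
   node turns x into a subsolution z of the undisturbed system.  The gap
   u_i = Z - z_i >= 0 to an upper bound Z is then a supersolution: it decays at
   most at the rate of the total weight, and passes from j to i along an edge
   active during a dwell time.  The spanning trees make the set of nodes at which
   u is bounded below by a fixed fraction of the leader's gap grow in every window,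
   so after N + 1 windows the maximum of |x| has contracted by a fixed factor, up
   to an exponentially small term. *)

(** * Minimum principle along switching trajectories *)

(** Left difference quotients at a minimum are nonpositive. The one-sided form matters because the
    minimum over [[a, t]] may be attained at [t] itself. *)
Lemma derive_at_left_min (R : realType) (f : R -> R) (a c d : R) :
  a < c -> is_derive c 1 f d -> (forall s, a <= s <= c -> f c <= f s) -> d <= 0.
Proof.
move=> ac [df <-] fmin.
have cvl : (fun h : R => h^-1 *: ((f \o shift c) (h *: 1) - f c)) @ 0^'-
    --> 'D_1 f c by apply: cvg_dnbhs_at_left; exact: df.
apply: (cvgr_to_le cvl); near=> h.
have h0 : h < 0 by near: h; exact: nbhs_left_lt.
have hac : a - c < h by near: h; apply: nbhs_left_gt; rewrite subr_lt0.
apply: mulr_le0_ge0; first by rewrite invr_le0 ltW.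
rewrite subr_ge0 /= [h *: 1]mulr1; apply: fmin; lra.
Unshelve. all: by end_near. Qed.

Lemma within_continuousM (R : realType) (D : set R) (f g : R -> R) :
  {within D, continuous f} -> {within D, continuous g} ->
  {within D, continuous (fun t => f t * g t)}.
Proof. by move=> cf cg x; apply: cvgM; [exact: cf|exact: cg]. Qed.

(* The weight [expR (- (L + 1) t)] makes the derivative strictly positive at a
   negative minimum over all indices and times, which a minimum attained after
   [a] forbids. *)
Lemma nonneg_of_min_derivative (R : realType) (I : finType) (a b L : R)
    (u du : I -> R -> R) :
  (forall i, {within `[a, b], continuous (u i)}) ->
  (forall i t, a < t < b -> is_derive t 1 (u i) (du i t)) ->
  (forall i t, a < t < b -> u i t < 0 -> (forall j, u i t <= u j t) ->
    L * u i t <= du i t) ->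
  (forall i, 0 <= u i a) -> forall i t, a <= t <= b -> 0 <= u i t.
Proof.
move=> uc ud hmin ua.
(* For [t < b] a minimum over [[a, t]] attained after [a] lies in the open interval, where
   derivatives exist; the endpoint [b] follows at the end by left continuity. *)
have lt_b i t : a <= t < b -> 0 <= u i t.
  case/andP=> at_ tb; rewrite leNgt; apply/negP => uit.
  pose e t := expR (- (L + 1) * t).
  pose G j t := e t * u j t.
  have Gc j : {within `[a, t], continuous (G j)}.
    apply: within_continuousM.
      apply: continuous_subspaceT => x.
      apply: (@continuous_comp _ _ _ (fun t => - (L + 1) * t) expR).
        exact: mulrl_continuous.
      exact: continuous_expR.
    apply: continuous_subspaceW (uc j); apply: subset_itvl.
    by rewrite bnd_simp ltW.
  have /choice[c cP] : forall j, exists c,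
      c \in `[a, t]%R /\ forall s, s \in `[a, t]%R -> G j c <= G j s.
    by move=> j; have [c c1 c2] := EVT_min at_ (Gc j); exists c.
  pose k := [arg min_(k < i) G k (c k)]%O.
  have kmin j : G k (c k) <= G j (c j).
    by rewrite /k; case: arg_minP => // m _; apply.
  have [cin cmin] := cP k.
  have kmin' j s : a <= s <= t -> G k (c k) <= G j s.
    by move=> st; apply: le_trans (kmin j) _; apply: (cP j).2; rewrite in_itv.
  have Gneg : G k (c k) < 0.
    apply: le_lt_trans (kmin' i t _) _; first by rewrite at_ lexx.
    by rewrite /G pmulr_rlt0 ?expR_gt0.
  move: cin; rewrite in_itv /= => /andP[ac ct].
  have ltac : a < c k.
    rewrite lt_neqAle ac andbT; apply/eqP => ca; move: Gneg; rewrite -ca ltNge.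
    by rewrite mulr_ge0 ?expR_ge0.
  have ab : a < c k < b by rewrite ltac (le_lt_trans ct).
  have uneg : u k (c k) < 0 by move: Gneg; rewrite /G pmulr_rlt0 ?expR_gt0.
  have dG : is_derive (c k) 1 (G k)
      (e (c k) * (du k (c k) - (L + 1) * u k (c k))).
    have := ud k _ ab => dk.
    have de : is_derive (c k) 1 e (e (c k) * (- (L + 1))).
      apply: is_derive1_comp.
      have := @is_deriveZ R R R id (- (L + 1)) (c k) 1 1 (is_derive_id _ _).
      by move=> h; apply: is_derive_eq h _; rewrite [_ *: _]mulr1.
    have := is_deriveM de dk; move=> h; apply: (is_derive_eq h).
    rewrite /GRing.scale /=; ring.
  have := @derive_at_left_min _ _ _ _ _ ltac dG => /(_ _)/wrap[].
    by move=> s /andP[s1 s2]; apply: kmin'; rewrite s1 (le_trans s2).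
  (* Here [du >= L * u] and [u < 0], hence [du - (L + 1) * u >= - u > 0]. *)
  apply/negP; rewrite -ltNge; apply: mulr_gt0; first exact: expR_gt0.
  have := hmin k _ ab uneg => /(_ _)/wrap[].
    move=> j; have := kmin' j (c k); rewrite ac ct => /(_ isT).
    by rewrite /G ler_pM2l ?expR_gt0.
  by move=> h; lra.
move=> i t /andP[at_]; rewrite le_eqVlt => /orP[/eqP tb|tb]; last first.
  by apply: lt_b; rewrite at_.
have := at_; rewrite le_eqVlt => /orP[/eqP <-//|lt_at].
rewrite tb in lt_at *.
have /(continuous_within_itvP _ lt_at)[_ _ ul] := uc i.
apply: (cvgr_to_ge ul); near=> s; apply: lt_b; apply/andP; split.
  by near: s; exact: nbhs_left_ge.
by near: s; exact: nbhs_left_lt.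
Unshelve. all: by end_near. Qed.

(** Derivatives are two-sided and required only inside the dwell intervals, so that the usual
    differentiation rules apply; continuity joins the intervals. *)
Definition trajectory (R : realType) (t_ : nat -> R) (u du : R -> R) :=
  {within `[0, +oo[, continuous u} /\
  forall l t, t_ l < t < t_ l.+1 -> is_derive t 1 u (du t).

(** * Differentiation rules for trajectories *)

Section TrajectoryAlgebra.
Variables (R : realType) (t_ : nat -> R).
Implicit Types u w du dw : R -> R.

Lemma trajectory_eq u du dw : trajectory t_ u du ->
  (forall l t, t_ l < t < t_ l.+1 -> du t = dw t) -> trajectory t_ u dw.
Proof.
by move=> [uc ud] E; split=> // l t lt; apply: is_derive_eq (ud _ _ lt) (E _ _ lt).
Qed.

Lemma trajectory_smooth u du :
  (forall t : R, is_derive t 1 u (du t)) -> trajectory t_ u du.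
Proof.
move=> ud; split=> [|l t _]; last exact: ud.
apply: continuous_subspaceT => t.
by have [du_t _] := ud t; apply: differentiable_continuous; exact/derivable1_diffP.
Qed.

Lemma trajectory_cst c : trajectory t_ (fun=> c) (fun=> 0).
Proof. by apply: trajectory_smooth => t; exact: is_derive_cst. Qed.

Lemma trajectoryD u du w dw : trajectory t_ u du -> trajectory t_ w dw ->
  trajectory t_ (fun t => u t + w t) (fun t => du t + dw t).
Proof.
move=> [uc ud] [wc wd]; split; first exact: within_continuousD.
by move=> l t lt; exact: is_deriveD (ud _ _ lt) (wd _ _ lt).
Qed.

Lemma trajectoryM u du w dw : trajectory t_ u du -> trajectory t_ w dw ->
  trajectory t_ (fun t => u t * w t) (fun t => du t * w t + u t * dw t).
Proof.
move=> [uc ud] [wc wd]; split; first exact: within_continuousM.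
move=> l t lt; apply: is_derive_eq (is_deriveM (ud _ _ lt) (wd _ _ lt)) _.
by rewrite /GRing.scale /= addrC [w t * _]mulrC.
Qed.

Lemma trajectoryZ c u du : trajectory t_ u du ->
  trajectory t_ (fun t => c * u t) (fun t => c * du t).
Proof.
move=> tu; apply: trajectory_eq (trajectoryM (trajectory_cst c) tu) _.
by move=> l t _; rewrite mul0r add0r.
Qed.

Lemma trajectoryN u du : trajectory t_ u du ->
  trajectory t_ (fun t => - u t) (fun t => - du t).
Proof.
move=> tu; have := trajectoryZ (-1) tu.
by under eq_fun do rewrite mulN1r; under [X in trajectory _ _ X]eq_fun do rewrite mulN1r.
Qed.

Lemma trajectoryB u du w dw : trajectory t_ u du -> trajectory t_ w dw ->
  trajectory t_ (fun t => u t - w t) (fun t => du t - dw t).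
Proof. by move=> tu tw; apply: trajectoryD => //; exact: trajectoryN. Qed.

Lemma trajectory_sum (I : finType) (u du : I -> R -> R) :
  (forall i, trajectory t_ (u i) (du i)) ->
  trajectory t_ (fun t => \sum_i u i t) (fun t => \sum_i du i t).
Proof.
move=> tu; elim: (index_enum I) => [|i s IH].
  under eq_fun do rewrite big_nil; under [X in trajectory _ _ X]eq_fun do rewrite big_nil.
  exact: trajectory_cst.
under eq_fun do rewrite big_cons; under [X in trajectory _ _ X]eq_fun do rewrite big_cons.
exact: trajectoryD.
Qed.

Lemma trajectory_expR c : trajectory t_ (fun t => expR (c * t))
  (fun t => c * expR (c * t)).
Proof.
apply: trajectory_smooth => t; rewrite [c * expR _]mulrC.
apply: is_derive1_comp; apply: is_derive_eq (is_deriveZ c (is_derive_id _ _)) _.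
by rewrite [_ *: _]mulr1.
Qed.

Lemma trajectory_cos c : trajectory t_ (fun t => cos (c * t))
  (fun t => - (c * sin (c * t))).
Proof.
apply: trajectory_smooth => t; rewrite mulrC -mulNr.
apply: is_derive1_comp; apply: is_derive_eq (is_deriveZ c (is_derive_id _ _)) _.
by rewrite [_ *: _]mulr1.
Qed.

Lemma trajectory_sin c : trajectory t_ (fun t => sin (c * t))
  (fun t => c * cos (c * t)).
Proof.
apply: trajectory_smooth => t; rewrite [c * cos _]mulrC.
apply: is_derive1_comp; apply: is_derive_eq (is_deriveZ c (is_derive_id _ _)) _.
by rewrite [_ *: _]mulr1.
Qed.

End TrajectoryAlgebra.

(** * Nonnegativity across switching instants *)

Section SwitchingInstants.
Variables (R : realType) (t_ : nat -> R).

Lemma bracket_instant (tau : R) (f : nat -> R) (t : R) : 0 < tau ->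
  (forall n, tau <= f n.+1 - f n) -> f 0%N <= t -> exists n, f n <= t < f n.+1.
Proof.
move=> tau0 gap f0t.
have lin n : f 0%N + n%:R * tau <= f n.
  elim: n => [|n IH]; first by rewrite mul0r addr0.
  by rewrite -natr1 mulrDl mul1r; have := gap n; lra.
have ex : exists n, t < f n.
  exists (Num.truncn ((t - f 0%N) / tau)).+1; apply: lt_le_trans (lin _).
  rewrite -ltrBlDl -ltr_pdivrMr //; exact: truncnS_gt.
(* The least index with [t < f n] is positive because [f 0 <= t]; its predecessor brackets [t]. *)
have := ex_minnP ex => -[[|n] ltn minn]; first by rewrite ltNge f0t in ltn.
exists n; rewrite ltn andbT leNgt; apply/negP => /minn; by rewrite ltnn.
Qed.

Hypothesis ht : switching_instants t_.

Lemma instants_homo : {homo t_ : m n / (m <= n)%N >-> m <= n}.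
Proof.
have [_ [tau [tau0 gap]]] := ht.
apply: homo_leq => [x|y x z|n]; [exact: lexx|exact: le_trans|].
by have := gap n; lra.
Qed.

Lemma instants_ge0 n : 0 <= t_ n.
Proof. by rewrite -ht.1; exact: instants_homo. Qed.

(** The minimum principle is applied on one dwell interval after another, each starting from the
    signs obtained at the end of the previous one. *)
Lemma trajectory_nonneg (I : finType) (L : R) (u du : I -> R -> R) (l : nat) :
  (forall i, trajectory t_ (u i) (du i)) ->
  (forall i m t, (l <= m)%N -> t_ m < t < t_ m.+1 -> u i t < 0 ->
    (forall j, u i t <= u j t) -> L * u i t <= du i t) ->
  (forall i, 0 <= u i (t_ l)) -> forall i t, t_ l <= t -> 0 <= u i t.
Proof.
move=> tu hmin u0.
have step m : (l <= m)%N -> (forall i, 0 <= u i (t_ m)) ->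
    forall i t, t_ m <= t <= t_ m.+1 -> 0 <= u i t.
  move=> lm um; apply: (@nonneg_of_min_derivative _ _ _ _ L _ du) => //.
  - move=> i; apply: continuous_subspaceW (tu i).1 => s /=; rewrite !in_itv /= andbT.
    by case/andP=> + _; apply: le_trans; exact: instants_ge0.
  - by move=> i t; exact: (tu i).2.
  - by move=> i t tm; exact: (hmin i m).
have [_ [tau [tau0 gap]]] := ht.
have um k : forall i, 0 <= u i (t_ (l + k)%N).
  elim: k => [|k IH]; first by rewrite addn0.
  move=> i; apply: (step (l + k)%N) => //; first exact: leq_addr.
  by rewrite addnS lexx instants_homo.
move=> i t lt; have [||n] := @bracket_instant tau (fun k => t_ (l + k)%N) t tau0.
- by move=> n; rewrite addnS; exact: gap.
- by rewrite addn0.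
move=> /andP[n1 n2]; apply: (step (l + n)%N) => //; first exact: leq_addr.
by rewrite n1 -addnS ltW.
Qed.

End SwitchingInstants.

(** * Consensus with an exponentially decaying disturbance *)

(** Splits an absolute value into two signed bounds, each of which the minimum principle can
    handle. *)
Lemma abs_le_of_signs (R : realType) (x m : R) :
  (forall b : bool, (-1) ^+ b * x <= m) -> `|x| <= m.
Proof.
move=> h; rewrite ler_norml; have := h false; have := h true.
by rewrite expr0 expr1 mul1r mulN1r; lra.
Qed.

(** * Boundedness under an integrable disturbance *)

Section ConsensusBound.
Variables (R : realType) (N : nat) (t_ : nat -> R) (K : finType).
Hypothesis ht : switching_instants t_.
Variables (a : R -> 'I_N.+1 -> 'I_N.+1 -> R) (y d : 'I_N.+1 -> K -> R -> R).
Variables beta lambda : R.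
Hypotheses (beta_ge0 : 0 <= beta) (lambda_gt0 : 0 < lambda).
Hypothesis a_ge0 : forall t i j, 0 <= a t i j.
Hypothesis y_leader : forall k (t : R), y ord0 k t = 0.
Hypothesis y_traj : forall i k, i != ord0 -> trajectory t_ (y i k)
  (fun t => \sum_j a t i j * (y j k t - y i k t) + d i k t).
Hypothesis d_le : forall i k (t m : R), i != ord0 -> 0 <= t ->
  (forall j k', `|y j k' t| <= m) ->
  `|d i k t| <= beta * expR (- lambda * t) * (1 + m).

(* [W] solves [W' = beta * exp (- lambda t) * (W + 1)], which stays bounded
   since the rate is integrable. *)
Lemma consensus_bounded : exists B : R, forall i k (t : R), 0 <= t -> `|y i k t| <= B.
Proof.
pose C : R := \sum_(p : 'I_N.+1 * K) `|y p.1 p.2 0|.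
have C0 : 0 <= C by apply: sumr_ge0.
have yC i k : `|y i k 0| <= C.
  by rewrite /C (bigD1 (i, k)) //= lerDl sumr_ge0.
pose e (t : R) : R := expR (- lambda * t).
have e0 (t : R) : 0 <= t -> 0 <= e t <= 1.
  move=> t0; rewrite expR_ge0 /= -[leRHS]expR0 ler_expR mulNr oppr_le0.
  by rewrite mulr_ge0 // ltW.
pose W (t : R) : R := (C + 1) * expR (beta / lambda * (1 - e t)) - 1.
have W0 : W 0 = C by rewrite /W /e mulr0 expR0 subrr mulr0 expR0; ring.
have Wge0 (t : R) : 0 <= t -> 0 <= W t.
  move=> t0; rewrite /W subr_ge0; have : 1 <= expR (beta / lambda * (1 - e t)).
    rewrite -{1}expR0 ler_expR; apply: mulr_ge0; first exact: divr_ge0 (ltW _).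
    by rewrite subr_ge0; case/andP: (e0 t t0).
  by move=> h; rewrite -[leLHS]mulr1 ler_pM // lerDr.
have Wtraj : trajectory t_ W (fun t => beta * e t * (W t + 1)).
  have te := trajectoryZ (beta / lambda)
    (trajectoryB (trajectory_cst t_ 1) (trajectory_expR t_ (- lambda))).
  have tE : trajectory t_ (fun t => expR (beta / lambda * (1 - e t)))
      (fun t => beta * e t * expR (beta / lambda * (1 - e t))).
    split.
      apply: (@within_continuous_comp _ _ _ _ _ expR _ te.1).
      by move=> x _; exact: continuous_expR.
    move=> l t lt; have := te.2 l t lt => dt.
    apply: is_derive_eq (is_derive1_comp (is_derive_expR _) dt) _.
    by rewrite /e; field; rewrite gt_eqF.
  apply: trajectory_eq (trajectoryB (trajectoryZ (C + 1) tE) (trajectory_cst t_ 1)) _.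
  by move=> l t _; rewrite /W; ring.
(* The family runs over nodes, components and signs at once, because the bound on one disturbance
   involves all components of all nodes. *)
pose u (p : 'I_N.+1 * K * bool) t := W t - (-1) ^+ p.2 * y p.1.1 p.1.2 t.
pose dy i k t := if i == ord0 then 0 else
  \sum_j a t i j * (y j k t - y i k t) + d i k t.
have ytraj i k : trajectory t_ (y i k) (dy i k).
  rewrite /dy; have [->|i0] := eqVneq i ord0; last exact: y_traj.
  have -> : y ord0 k = (fun=> 0) by apply/funext => t; exact: y_leader.
  exact: trajectory_cst.
pose du (p : 'I_N.+1 * K * bool) t :=
  beta * e t * (W t + 1) - (-1) ^+ p.2 * dy p.1.1 p.1.2 t.
have utraj p : trajectory t_ (u p) (du p).
  by apply: trajectoryB => //; exact: trajectoryZ.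
have unn : forall p t, 0 <= t -> 0 <= u p t.
  move=> p t; rewrite -{1}ht.1; move: p t; apply: (trajectory_nonneg ht (L := beta) utraj).
    move=> [[i k] b] m t _ /andP[tm _] uneg umin.
    have t0 : 0 <= t by apply/ltW/(le_lt_trans (instants_ge0 ht m)).
    have [i0|i0] := eqVneq i ord0.
      by move: uneg; rewrite /u /= i0 y_leader mulr0 subr0 ltNge Wge0.
    (* At a common minimum with value [u (i, k, b) t], every [|y j k' t|] is at most
       [W t - u (i, k, b) t]. *)
    have dle : `|d i k t| <= beta * e t * (1 + (W t - u (i, k, b) t)).
      apply: d_le => // j k'; apply: abs_le_of_signs => b'.
      by have := umin (j, k', b'); rewrite {2}/u /=; lra.
    have sd : (-1) ^+ b * d i k t <= `|d i k t|.
      by apply: le_trans (ler_norm _) _; rewrite normrMsign.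
    have cons : (-1) ^+ b * (\sum_j a t i j * (y j k t - y i k t)) <= 0.
      rewrite mulr_sumr; apply: sumr_le0 => j _.
      rewrite mulrCA; apply: mulr_ge0_le0 => //.
      by have := umin (j, k, b); rewrite /u /=; lra.
    have -> : du (i, k, b) t = beta * e t * (W t + 1) -
        ((-1) ^+ b * (\sum_j a t i j * (y j k t - y i k t)) + (-1) ^+ b * d i k t).
      by rewrite /du /= /dy (negPf i0) -mulrDr.
    (* Since [e t <= 1] and [u] is negative here, the time-dependent rate may be replaced by the
       constant [beta]. *)
    have eu : beta * u (i, k, b) t <= beta * e t * u (i, k, b) t.
      rewrite -mulrA; apply: ler_wpM2l => //.
      have /andP[_ e1] := e0 t t0.
      by rewrite -[leLHS]mul1r ler_wnM2r // ltW.
    move: (u (i, k, b) t) dle eu => ut dle eu.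
    by move: (\sum_j _) (W t) (e t) dle sd cons eu => *; lra.
  move=> [[i k] b]; rewrite /u /= ht.1 W0 subr_ge0.
  by apply: le_trans (yC i k); apply: le_trans (ler_norm _) _; rewrite normrMsign.
pose B := (C + 1) * expR (beta / lambda).
exists B => i k t t0; apply: (@le_trans _ _ (W t)).
  by apply: abs_le_of_signs => b; have := unn (i, k, b) t t0; rewrite /u /= subr_ge0.
rewrite /W /B; have : expR (beta / lambda * (1 - e t)) <= expR (beta / lambda).
  rewrite ler_expR ler_piMr ?divr_ge0 ?(ltW lambda_gt0) //.
  by have /andP[] := e0 t t0; lra.
move=> h; rewrite lerBlDr; apply: le_trans (_ : B <= _); last by rewrite /B lerDl.
by rewrite /B ler_wpM2l // addr_ge0.
Qed.

End ConsensusBound.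

(** * Propagation of lower bounds through the network *)

Section ConsensusContraction.
Variables (R : realType) (N : nat) (t_ : nat -> R).
Hypothesis ht : switching_instants t_.
Variables (a : R -> 'I_N.+1 -> 'I_N.+1 -> R) (E : nat -> rel 'I_N.+1).
Variables (c amin tau eps : R) (i_ : nat -> nat).
Hypotheses (c_gt0 : 0 < c) (amin_gt0 : 0 < amin) (tau_gt0 : 0 < tau).
Hypothesis a_ge0 : forall t i j, 0 <= a t i j.
Hypothesis a_le : forall t i, \sum_j a t i j <= c.
Hypothesis a_edge : forall l (t : R) i j,
  t_ l < t < t_ l.+1 -> E l j i -> amin <= a t i j.
Hypothesis dwell : forall l, tau <= t_ l.+1 - t_ l.
Hypothesis i_homo : {homo i_ : k l / (k < l)%N}.
Hypothesis window_lt : forall k, t_ (i_ k.+1) - t_ (i_ k) < eps.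
Hypothesis window_edge : forall k (P : {set 'I_N.+1}), ord0 \in P -> (#|P| < N.+1)%N ->
  exists l j i, [/\ (i_ k <= l < i_ k.+1)%N, j \in P, i \notin P & E l j i].

(* The fraction of a lower bound that survives a window: a node decays before and
   after an edge to it is active, and gains [amin / c * (1 - exp (- c tau))] times
   the level of its neighbour while it is. *)
Definition window_retention : R :=
  expR (- c * eps) ^+ 2 * Num.min 1 (amin / c * (1 - expR (- c * tau))).

Lemma window_retention_gt0 : 0 < window_retention.
Proof.
rewrite /window_retention mulr_gt0 ?exprn_gt0 ?expR_gt0 // lt_min ltr01 /=.
rewrite mulr_gt0 ?divr_gt0 // subr_gt0 -expR0 ltr_expR.
by rewrite mulNr oppr_lt0 mulr_gt0.
Qed.

Lemma window_retention_le1 : window_retention <= 1.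
Proof.
have eps0 : 0 <= eps.
  have := window_lt 0; have := @instants_homo _ _ ht (i_ 0%N) (i_ 1%N).
  by rewrite ltnW ?i_homo // => /(_ isT); lra.
rewrite /window_retention mulr_ile1 ?exprn_ge0 ?expR_ge0 //.
- rewrite le_min ler01 /= mulr_ge0 ?divr_ge0 ?ltW // subr_gt0 -expR0 ltr_expR.
  by rewrite mulNr oppr_lt0 mulr_gt0.
- rewrite exprn_ile1 ?expR_ge0 // -expR0 ler_expR mulNr oppr_le0.
  by rewrite mulr_ge0 // ltW.
- by rewrite ge_min lexx.
Qed.

Section Supersolution.
Variables u du : 'I_N.+1 -> R -> R.
Hypothesis u_traj : forall i, trajectory t_ (u i) (du i).
Hypothesis du_leader : forall t : R, 0 <= t -> 0 <= du ord0 t.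
Hypothesis du_follower : forall i (t : R), i != ord0 -> 0 <= t ->
  \sum_j a t i j * (u j t - u i t) <= du i t.

(** At a node of minimal value all the differences [u j t - u i t] are nonnegative, so the minimum
    principle applies with rate [0]. *)
Lemma supersolution_ge0 l : (forall i, 0 <= u i (t_ l)) ->
  forall i t, t_ l <= t -> 0 <= u i t.
Proof.
apply: (trajectory_nonneg ht (L := 0) u_traj) => i m t _ /andP[tm _] _ umin.
have t0 : 0 <= t by apply/ltW/(le_lt_trans (instants_ge0 ht m)).
rewrite mul0r; have [->|i0] := eqVneq i ord0; first exact: du_leader.
apply: le_trans (du_follower i0 t0); apply: sumr_ge0 => j _.
by rewrite mulr_ge0 // subr_ge0.
Qed.

Variable l0 : nat.
Hypothesis u_start : forall i, 0 <= u i (t_ l0).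

Let u_ge0 := supersolution_ge0 u_start.

Lemma supersolution_decay i (t : R) : t_ l0 <= t -> - c * u i t <= du i t.
Proof.
move=> lt; have t0 : 0 <= t := le_trans (instants_ge0 ht l0) lt.
have [->|i0] := eqVneq i ord0.
  apply: le_trans (du_leader t0); rewrite mulNr oppr_le0.
  by rewrite mulr_ge0 ?u_ge0 // ltW.
apply: le_trans (du_follower i0 t0).
rewrite (eq_bigr (fun j => a t i j * u j t - a t i j * u i t)); last first.
  by move=> j _; rewrite mulrBr.
rewrite big_split /= sumrN -mulr_suml mulNr.
have : 0 <= \sum_j a t i j * u j t by apply: sumr_ge0 => j _; rewrite mulr_ge0 ?u_ge0.
have : (\sum_j a t i j) * u i t <= c * u i t by rewrite ler_wpM2r ?u_ge0.
by lra.
Qed.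

Lemma supersolution_persist i l (t : R) : (l0 <= l)%N -> t_ l <= t ->
  expR (- c * (t - t_ l)) * u i (t_ l) <= u i t.
Proof.
(* The factor [k] makes [k * expR (- c * t)] agree with [u i] at [t_ l]; below this curve [u i]
   decays no faster than the curve. *)
move=> l0l lt; pose k := expR (c * t_ l) * u i (t_ l).
have -> : expR (- c * (t - t_ l)) * u i (t_ l) = k * expR (- c * t).
  by rewrite /k mulrBr !mulNr opprK expRD; ring.
rewrite -subr_ge0.
pose w (_ : unit) (t : R) := u i t - k * expR (- c * t).
have wtraj x : trajectory t_ (w x) (fun t => du i t - k * (- c * expR (- c * t))).
  by apply: trajectoryB => //; apply: trajectoryZ; exact: trajectory_expR.
have := trajectory_nonneg ht (L := 0) (l := l) wtraj.
move=> /(_ _)/wrap[|h].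
  move=> x m s lm /andP[ms _] + _; rewrite /w mul0r => ws.
  have t0s : t_ l0 <= s.
    by apply/ltW/(le_lt_trans _ ms); apply: instants_homo => //; exact: leq_trans lm.
  have := supersolution_decay i t0s.
  have : 0 <= c * (k * expR (- c * s) - u i s) by rewrite mulr_ge0 ?ltW //; lra.
  by lra.
apply: (h _ tt t lt) => x; rewrite /w /k mulrAC -expRD mulNr addrN expR0 mul1r.
by rewrite subrr.
Qed.

(** While the edge is active, [u_i' >= amin * g - c * u_i]. Comparison with the solution of the
    equality case that starts from [0], evaluated after a dwell time of at least [tau], gives the
    bound. *)
Lemma supersolution_edge l i j g : (l0 <= l)%N -> i != ord0 -> 0 <= g ->
  (forall t, t_ l < t < t_ l.+1 -> amin <= a t i j) ->
  (forall t, t_ l < t < t_ l.+1 -> g <= u j t) ->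
  amin / c * (1 - expR (- c * tau)) * g <= u i (t_ l.+1).
Proof.
move=> l0l i0 g0 aij uj.
(* [k] is the equilibrium of [x' = amin * g - c * x], and [h] makes the comparison solution vanish
   at [t_ l]. *)
pose k := amin / c * g; pose h := expR (c * t_ l).
pose w (_ : unit) (t : R) := u i t - k * (1 - h * expR (- c * t)).
have wtraj x : trajectory t_ (w x)
    (fun t => du i t - k * (0 - h * (- c * expR (- c * t)))).
  apply: trajectoryB => //; apply: trajectoryZ; apply: trajectoryB.
    exact: trajectory_cst.
  by apply: trajectoryZ; exact: trajectory_expR.
have le_l : t_ l <= t_ l.+1 by exact: instants_homo.
have := @nonneg_of_min_derivative R unit (t_ l) (t_ l.+1) 0 w
  (fun _ t => du i t - k * (0 - h * (- c * expR (- c * t)))).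
move=> /(_ _ _ _ _ tt (t_ l.+1))/wrap[||||].
- move=> x; apply: continuous_subspaceW (wtraj x).1 => s /=; rewrite !in_itv /= andbT.
  by case/andP=> + _; apply: le_trans; exact: instants_ge0.
- by move=> x t; exact: (wtraj x).2.
- move=> x t lt + _; rewrite mul0r /w => wt.
  have /andP[lt1 lt2] := lt.
  have l0t : t_ l0 <= t by apply/ltW/(le_lt_trans _ lt1)/instants_homo.
  have t0 : 0 <= t := le_trans (instants_ge0 ht l0) l0t.
  have := du_follower i0 t0.
  rewrite (eq_bigr (fun j => a t i j * u j t - a t i j * u i t)); last first.
    by move=> ? _; rewrite mulrBr.
  rewrite big_split /= sumrN -mulr_suml.
  have au : amin * g <= \sum_j a t i j * u j t.
    rewrite (bigD1 j) //=; apply: ler_wpDr.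
      by apply: sumr_ge0 => j' _; rewrite mulr_ge0 ?u_ge0.
    by apply: ler_pM; rewrite ?(ltW amin_gt0) ?aij ?uj.
  have cu : (\sum_j a t i j) * u i t <= c * u i t by rewrite ler_wpM2r ?u_ge0.
  have ck : c * k = amin * g by rewrite /k; field; rewrite gt_eqF.
  have : 0 <= c * (k * (1 - h * expR (- c * t)) - u i t).
    by rewrite mulr_ge0 ?(ltW c_gt0) //; lra.
  move: (\sum_j a t i j * u j t) (\sum_j a t i j) au cu => X Y au cu.
  have -> : k * (0 - h * (- c * expR (- c * t))) = c * k * (h * expR (- c * t)) by ring.
  rewrite mulrBr (mulrA c) ck; lra.
- move=> x; rewrite /w /h -expRD mulNr addrN expR0 subrr mulr0 subr0.
  by apply: u_ge0; exact: instants_homo.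
rewrite le_l lexx => /(_ isT); rewrite /w subr_ge0; apply: le_trans.
rewrite /k mulrAC ler_wpM2l ?mulr_ge0 ?invr_ge0 ?(ltW c_gt0) ?(ltW amin_gt0) //.
rewrite /h -expRD lerD2l lerN2 ler_expR.
have := dwell l; have : 0 < c := c_gt0; by nra.
Qed.

(** Nodes of [P] keep their level up to decay, and an edge leaving [P] during the window recruits a
    new node. The [minn] covers the case where [P] already contains every node. *)
Lemma supersolution_window k (P : {set 'I_N.+1}) g : (l0 <= i_ k)%N ->
  ord0 \in P -> 0 <= g -> (forall j, j \in P -> g <= u j (t_ (i_ k))) ->
  exists2 P' : {set 'I_N.+1}, ord0 \in P' /\ (minn #|P|.+1 N.+1 <= #|P'|)%N
    & forall j, j \in P' -> window_retention * g <= u j (t_ (i_ k.+1)).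
Proof.
move=> l0k P0 g0 uP; set e := expR (- c * eps).
have e0 : 0 <= e by exact: expR_ge0.
have le_e (s : R) : s <= eps -> e <= expR (- c * s).
  by move=> se; rewrite /e ler_expR; have : 0 < c := c_gt0; nra.
have ik : (i_ k <= i_ k.+1)%N by rewrite ltnW // i_homo.
have eps0 : 0 <= eps by have := window_lt k; have := instants_homo ht ik; lra.
have e1 : e <= 1 by rewrite /e -expR0 ler_expR mulNr oppr_le0 mulr_ge0 // ltW.
(* Any two instants of the window are less than [eps] apart, so one factor [e] pays for any decay
   inside it. *)
have persist j l m x : (i_ k <= l)%N -> (l <= m)%N -> (m <= i_ k.+1)%N -> 0 <= x ->
    x <= u j (t_ l) -> forall t, t_ l <= t <= t_ m -> e * x <= u j t.
  move=> kl lm mk x0 xl t /andP[t1 t2].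
  apply: le_trans (supersolution_persist j (leq_trans l0k kl) t1).
  apply: ler_pM => //; apply: le_e.
  have := window_lt k; have := instants_homo ht kl; have := instants_homo ht mk.
  by lra.
have keepP x : 0 <= x -> window_retention * x <= e * x.
  move=> x0; rewrite ler_wpM2r // /window_retention -/e expr2 -mulrA ler_piMr //.
  by rewrite mulr_ile1 // ?ge_min ?lexx // le_min ler01 /= mulr_ge0 ?divr_ge0 ?(ltW c_gt0) ?(ltW amin_gt0) //
    subr_ge0 -expR0 ler_expR mulNr oppr_le0 mulr_ge0 ?(ltW c_gt0) ?(ltW tau_gt0).
have old j : j \in P -> window_retention * g <= u j (t_ (i_ k.+1)).
  move=> jP; apply: le_trans (keepP _ g0) _.
  apply: (persist j (i_ k) (i_ k.+1)) => //; first exact: uP.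
  by rewrite lexx instants_homo.
have [PT|PT] := leqP N.+1 #|P|.
  by exists P => //; split=> //; rewrite geq_min PT orbT.
have [l [j [i [/andP[kl lk] jP iP Eji]]]] := window_edge k P0 PT.
exists (i |: P).
  by rewrite in_setU1 P0 orbT cardsU1 iP add1n geq_minl.
move=> i'; rewrite in_setU1 => /predU1P[->|]; last exact: old.
have i0 : i != ord0 by apply: contraNneq iP => ->.
have uj t : t_ l < t < t_ l.+1 -> e * g <= u j t.
  case/andP=> t1 t2; apply: (persist j (i_ k) l.+1) => //; first exact: leqW.
    exact: uP.
  by rewrite (ltW t2) andbT; apply: le_trans (ltW t1); exact: instants_homo.
have := supersolution_edge (leq_trans l0k kl) i0 (mulr_ge0 e0 g0) (fun t lt => a_edge lt Eji) uj.
set q := amin / c * _ => qu.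
have q0 : 0 <= Num.min 1 q.
  rewrite le_min ler01 /= mulr_ge0 ?divr_ge0 ?(ltW c_gt0) ?(ltW amin_gt0) //.
  by rewrite subr_ge0 -expR0 ler_expR mulNr oppr_le0 mulr_ge0 ?(ltW c_gt0) ?(ltW tau_gt0).
(* From right to left: [j] decays up to the end of the edge's interval, [i] receives its share
   there, and [i] decays until the end of the window. *)
have -> : window_retention * g = e * (Num.min 1 q * (e * g)).
  by rewrite /window_retention -/e -/q; ring.
apply: (persist i l.+1 (i_ k.+1)) => //.
- exact: leqW.
- by rewrite !mulr_ge0.
- apply: le_trans qu; rewrite ler_wpM2r ?mulr_ge0 //.
  by rewrite ge_min lexx orbT.
- by rewrite lexx instants_homo.
Qed.

(** The set starts as the leader alone and has at least [minn n.+1 N.+1] nodes after [n] windows,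
    hence is everything after [N.+1] windows. *)
Lemma supersolution_contraction k : l0 = i_ k ->
  forall i, window_retention ^+ N.+1 * u ord0 (t_ (i_ k)) <= u i (t_ (i_ (k + N.+1)%N)).
Proof.
move=> l0E i; set g := u ord0 _.
have g0 : 0 <= g by apply: u_ge0; rewrite l0E.
have keep0 := ltW window_retention_gt0.
have ikn n : (i_ k <= i_ (k + n)%N)%N.
  by case: n => [|n]; rewrite ?addn0 // ltnW // i_homo // addnS ltnS leq_addr.
have main n : exists2 P : {set 'I_N.+1}, ord0 \in P /\ (minn n.+1 N.+1 <= #|P|)%N
    & forall j, j \in P -> window_retention ^+ n * g <= u j (t_ (i_ (k + n)%N)).
  elim: n => [|n [P [P0 Pn] uP]].
    exists [set ord0]%SET; first by rewrite finset.set11 cards1 geq_minl.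
    by move=> j /finset.set1P ->; rewrite expr0 mul1r addn0.
  have := supersolution_window _ P0 (mulr_ge0 (exprn_ge0 n keep0) g0) uP.
  rewrite l0E => /(_ (ikn n)) [P' [P'0 P'n] uP']; exists P'.
    by split=> //; apply: leq_trans P'n; move: Pn; set p := #|_|; lia.
  by move=> j jP; rewrite exprS -mulrA addnS; exact: uP'.
have [P [_ Pn] uP] := main N.+1; apply: uP.
suff /setP/(_ i) -> : P = [set: 'I_N.+1]%SET by rewrite finset.in_setT.
apply/eqP; rewrite eqEcard finset.subsetT cardsT card_ord /=.
by apply: leq_trans Pn; rewrite leq_min leqnSn leqnn.
Qed.

End Supersolution.
End ConsensusContraction.

(** * Exponential rate from the contraction over cycles of [N.+1] windows *)

Section ConsensusRate.
Variables (R : realType) (N : nat) (t_ : nat -> R).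
Hypothesis ht : switching_instants t_.
Variables (a : R -> 'I_N.+1 -> 'I_N.+1 -> R) (E : nat -> rel 'I_N.+1).
Variables (c amin tau eps lambda : R) (i_ : nat -> nat).
Hypotheses (c_gt0 : 0 < c) (amin_gt0 : 0 < amin) (tau_gt0 : 0 < tau).
Hypotheses (eps_gt0 : 0 < eps) (lambda_gt0 : 0 < lambda).
Hypothesis a_ge0 : forall t i j, 0 <= a t i j.
Hypothesis a_le : forall t i, \sum_j a t i j <= c.
Hypothesis a_edge : forall l (t : R) i j,
  t_ l < t < t_ l.+1 -> E l j i -> amin <= a t i j.
Hypothesis dwell : forall l, tau <= t_ l.+1 - t_ l.
Hypothesis i_homo : {homo i_ : k l / (k < l)%N}.
Hypothesis window_lt : forall k, t_ (i_ k.+1) - t_ (i_ k) < eps.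
Hypothesis window_edge : forall k (P : {set 'I_N.+1}), ord0 \in P -> (#|P| < N.+1)%N ->
  exists l j i, [/\ (i_ k <= l < i_ k.+1)%N, j \in P, i \notin P & E l j i].

Definition cycle_retention : R := window_retention c amin tau eps ^+ N.+1.

Lemma cycle_retention_bounds : 0 < cycle_retention <= 1.
Proof.
have keep0 := window_retention_gt0 eps c_gt0 amin_gt0 tau_gt0.
rewrite /cycle_retention exprn_gt0 //= exprn_ile1 ?(ltW keep0) //.
exact: (window_retention_le1 ht c_gt0 amin_gt0 tau_gt0 i_homo window_lt).
Qed.

Section Disturbed.
Variables (y d : 'I_N.+1 -> R -> R) (B : R).
Hypothesis B_ge0 : 0 <= B.
Hypothesis y_leader : forall t : R, y ord0 t = 0.
Hypothesis y_traj : forall i, i != ord0 -> trajectory t_ (y i)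
  (fun t => \sum_j a t i j * (y j t - y i t) + d i t).
Hypothesis d_le : forall i (t : R), i != ord0 -> 0 <= t ->
  `|d i t| <= B * expR (- lambda * t).

Let C := B / lambda.
Let C_ge0 : 0 <= C. Proof. exact: divr_ge0 (ltW _). Qed.

(* Adding [C * exp (- lambda t)] to every node, the leader included, leaves the
   differences unchanged and absorbs the disturbance. *)
Lemma disturbed_bounds l (M : R) : (forall i, `|y i (t_ l)| <= M) ->
  (forall i t, t_ l <= t -> `|y i t| <= M + C * expR (- lambda * t_ l)) /\
  (forall k, l = i_ k -> forall i, `|y i (t_ (i_ (k + N.+1)%N))|
     <= (1 - cycle_retention) * M + C * expR (- lambda * t_ l)).
Proof.
move=> yM.
pose Z := M + C * expR (- lambda * t_ l).
pose dy i (t : R) := if i == ord0 then 0 else \sum_j a t i j * (y j t - y i t) + d i t.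
have ytraj i : trajectory t_ (y i) (dy i).
  rewrite /dy; have [->|i0] := eqVneq i ord0; last exact: y_traj.
  have -> : y ord0 = (fun=> 0) by apply/funext => t; exact: y_leader.
  exact: trajectory_cst.
have e_ge0 (t : R) : 0 <= C * expR (- lambda * t) by rewrite mulr_ge0 ?expR_ge0.
(* Gap below [Z] of the shifted signed solution; [Z] is chosen so that all gaps are nonnegative at
   [t_ l]. *)
pose u (b : bool) i (t : R) := Z - ((-1) ^+ b * y i t + C * expR (- lambda * t)).
pose du (b : bool) i (t : R) :=
  0 - ((-1) ^+ b * dy i t + C * (- lambda * expR (- lambda * t))).
have CE (t : R) : C * (- lambda * expR (- lambda * t)) = - (B * expR (- lambda * t)).
  by rewrite /C; field; rewrite gt_eqF.
have utraj b i : trajectory t_ (u b i) (du b i).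
  apply: trajectoryB; first exact: trajectory_cst.
  apply: trajectoryD; first exact: trajectoryZ.
  by apply: trajectoryZ; exact: trajectory_expR.
have du0 b (t : R) : 0 <= t -> 0 <= du b ord0 t.
  move=> _; rewrite /du /dy eqxx mulr0 CE add0r sub0r opprK.
  by rewrite mulr_ge0 ?expR_ge0.
have duf b i (t : R) : i != ord0 -> 0 <= t ->
    \sum_j a t i j * (u b j t - u b i t) <= du b i t.
  move=> i0 t0; rewrite /du /dy (negPf i0) CE.
  rewrite (eq_bigr (fun j => - ((-1) ^+ b * (a t i j * (y j t - y i t))))); last first.
    by move=> j _; rewrite /u; ring.
  rewrite sumrN -mulr_sumr mulrDr.
  have : (-1) ^+ b * d i t <= `|d i t|.
    by apply: le_trans (ler_norm _) _; rewrite normrMsign.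
  have := d_le i0 t0; move: (\sum_j _) => X; lra.
have ustart b i : 0 <= u b i (t_ l).
  rewrite /u /Z; have := yM i.
  have : (-1) ^+ b * y i (t_ l) <= `|y i (t_ l)|.
    by apply: le_trans (ler_norm _) _; rewrite normrMsign.
  by lra.
split=> [i t lt|k lk i]; apply: abs_le_of_signs => b.
  have := supersolution_ge0 ht a_ge0 (utraj b) (du0 b) (duf b) (ustart b) i lt.
  by have := e_ge0 t; rewrite /u /Z; lra.
have := supersolution_contraction ht c_gt0 amin_gt0 tau_gt0 a_ge0 a_le a_edge dwell
  i_homo window_lt window_edge (utraj b) (du0 b) (duf b) (ustart b) lk i.
(* The two exponential terms cancel for the leader at [t_ l], so its initial gap is exactly [M]. *)
rewrite -/cycle_retention -lk {1}/u y_leader mulr0 add0r /Z addrK /u /Z.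
by have := e_ge0 (t_ (i_ (k + N.+1)%N)); lra.
Qed.

End Disturbed.

(** The contraction is iterated at sampling times one cycle apart, then extended to the times in
    between. The rate is quantified before the solution so that finitely many components can share
    it. *)
Lemma consensus_rate : exists2 lambda' : R, 0 < lambda' & forall y d B,
  0 <= B -> (forall t : R, y ord0 t = 0) ->
  (forall i, i != ord0 -> trajectory t_ (y i)
    (fun t => \sum_j a t i j * (y j t - y i t) + d i t)) ->
  (forall i (t : R), i != ord0 -> 0 <= t -> `|d i t| <= B * expR (- lambda * t)) ->
  exists alpha : R, forall i (t : R), 0 <= t ->
    `|y i t| <= alpha * expR (- lambda' * t).
Proof.
pose T : R := N.+1%:R * eps.
have T0 : 0 < T by rewrite mulr_gt0 // ltr0n.
have /andP[g0 g1] := cycle_retention_bounds.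
set g := cycle_retention in g0 g1.
(* [la <= lambda] lets the disturbance decay at least as fast as the claimed bound;
   [la * T <= g / 2] makes that bound shrink per cycle by a factor of at least [1 - g / 2]. *)
pose la : R := Num.min lambda (g / (2 * T)).
have la0 : 0 < la by rewrite lt_min lambda_gt0 divr_gt0 ?mulr_gt0.
have la_le : la <= lambda by rewrite ge_min lexx.
have laT : la * T <= g / 2.
  rewrite -ler_pdivlMr //; apply: (@le_trans _ _ (g / (2 * T))).
    by rewrite ge_min lexx orbT.
  by rewrite invfM mulrA.
exists la => // y d B B0 yl yt dl; set C := B / lambda.
have C0 : 0 <= C by exact: divr_ge0 (ltW _).
have step := disturbed_bounds B0 yl yt dl.
pose M := \sum_i `|y i 0|; pose M0 := M + C.
have yM0 i (t : R) : 0 <= t -> `|y i t| <= M0.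
  move=> t0; have [|h _] := step 0%N M.
    by move=> j; rewrite ht.1 /M (bigD1 j) //= lerDl sumr_ge0.
  by have := h i t; rewrite ht.1 mulr0 expR0 mulr1; apply.
have M00 : 0 <= M0 by rewrite addr_ge0 // sumr_ge0.
pose s n := t_ (i_ (n * N.+1)%N).
have s_ge0 n : 0 <= s n by exact: (instants_ge0 ht).
have sT n : s n.+1 - s n <= T.
  rewrite /s /T mulSnr; move: (n * N.+1)%N => k.
  elim: N.+1 => [|m IH]; first by rewrite addn0 subrr mul0r.
  by rewrite addnS -natr1 mulrDl mul1r; have := window_lt (k + m)%N; lra.
have stau n : tau <= s n.+1 - s n.
  have lt : (i_ (n * N.+1) < i_ (n.+1 * N.+1))%N by apply: i_homo; rewrite ltn_pmul2r.
  by have := instants_homo ht lt; have := dwell (i_ (n * N.+1)%N); rewrite /s; lra.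
(* The first term dominates the solution at the first sampling time, which may be positive; the
   second ensures [C <= g * K / 2]. *)
pose K := M0 * expR (la * s 0%N) + 2 * C / g.
have M0K : M0 * expR (la * s 0%N) <= K.
  by rewrite /K lerDl; apply: divr_ge0 (ltW g0); exact: mulr_ge0.
have K0 : 0 <= K by apply: le_trans M0K; rewrite mulr_ge0 ?expR_ge0.
have CK : C <= g * K / 2.
  have -> : g * K / 2 = g * (M0 * expR (la * s 0%N)) / 2 + C.
    by rewrite /K; field; rewrite gt_eqF.
  by rewrite lerDr divr_ge0 // mulr_ge0 ?(ltW g0) // mulr_ge0 ?expR_ge0.
have Ce (t : R) : 0 <= t -> C * expR (- lambda * t) <= C * expR (- la * t).
  by move=> t0; rewrite ler_wpM2l // ler_expR !mulNr lerN2 ler_wpM2r.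
have sK n i : `|y i (s n)| <= K * expR (- la * s n).
  elim: n i => [|n IH] i.
    apply: le_trans (yM0 i _ (s_ge0 0%N)) _.
    apply: le_trans (ler_wpM2r (expR_ge0 _) M0K).
    by rewrite -mulrA -expRD mulNr addrN expR0 mulr1.
  have [_ h] := step _ _ IH; have := h _ erefl i; rewrite -/g -/(s n).
  rewrite /s mulSnr -/(s n) -mulSnr -/(s n.+1) => {}h; apply: le_trans h _.
  have e0 : 0 <= expR (- la * s n) by exact: expR_ge0.
  have -> : K * expR (- la * s n.+1)
      = K * expR (- la * s n) * expR (- la * (s n.+1 - s n)).
    by rewrite -mulrA -expRD; congr (_ * expR _); ring.
  have e1 : 1 - g / 2 <= expR (- la * (s n.+1 - s n)).
    apply: le_trans (expR_ge1Dx _); rewrite mulNr lerD2l lerN2.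
    by apply: le_trans laT; rewrite ler_wpM2l // ltW.
  (* Half of the contraction absorbs the disturbance: [(1 - g) * K + C <= (1 - g / 2) * K]. *)
  apply: le_trans (ler_wpM2l (mulr_ge0 K0 e0) e1).
  rewrite -/C -/(s n); have := Ce _ (s_ge0 n); have := ler_wpM2r e0 CK; lra.
(* The factor [expR (la * T)] pays for the time elapsed since the last sampling time. *)
exists ((K + C) * expR (la * T)) => i t t0.
have e1 : 1 <= expR (la * T) by rewrite -expR0 ler_expR mulr_ge0 // ltW.
have [ts|ts] := ltP t (s 0%N).
  apply: le_trans (yM0 i t t0) _.
  have M0e : M0 <= M0 * expR (la * s 0%N) * expR (- la * t).
    rewrite -mulrA -expRD ler_peMr // -expR0 ler_expR.
    have -> : la * s 0%N + - la * t = la * (s 0%N - t) by ring.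
    by apply: mulr_ge0; [exact: ltW|rewrite subr_ge0 ltW].
  apply: le_trans M0e _; rewrite ler_wpM2r ?expR_ge0 //; apply: le_trans M0K _.
  by apply: (@le_trans _ _ (K + C)); rewrite ?lerDl // ler_peMr // addr_ge0.
have [n /andP[n1 n2]] := bracket_instant tau_gt0 stau ts.
have [h _] := step _ _ (sK n); apply: le_trans (h i t n1) _.
apply: (@le_trans _ _ ((K + C) * expR (- la * s n))).
  by have := Ce _ (s_ge0 n); rewrite -/C -/(s n); lra.
have KC0 : 0 <= K + C by exact: addr_ge0.
rewrite -mulrA ler_wpM2l // -expRD ler_expR.
have -> : la * T + - la * t = la * (T - t) by ring.
rewrite mulNr -mulrN ler_wpM2l ?(ltW la0) //; have := sT n; lra.
Qed.

End ConsensusRate.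

(** A tree path from the root to a node outside [P] must leave [P]; its first exiting edge is the
    one sought. *)
Lemma spanning_tree_crossing (V : finType) (e : rel V) (root : V) (P : {set V}) :
  has_spanning_tree e root -> root \in P -> (#|P| < #|V|)%N ->
  exists j i, [/\ j \in P, i \notin P & e j i].
Proof.
move=> [T [subT _ _ conn]] rP ltP.
have [x xP] : exists x, x \notin P.
  apply/existsP; rewrite -negb_forall; apply/negP => /forallP allP.
  move: ltP; rewrite -cardsT ltnNge subset_leq_card //.
  by apply/fintype.subsetP => x _; exact: allP.
have /connectP[p pT lastp] : connect T root x.
  by apply: conn; apply: contraNneq xP => ->.
elim: p root rP pT lastp {conn} => [r rP _ xr|y p IH r rP /= /andP[ry yp] lastx].
  by rewrite xr rP in xP.
have [yP|yP] := boolP (y \in P); first exact: (IH y).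
by exists r, y; split=> //; exact: subT.
Qed.

(** * Consensus over jointly connected switching digraphs *)

Section PerturbedConsensus.
Variables (R : realType) (N n0 : nat) (t_ : nat -> R) (sigma : R -> 'I_n0).
Variables (E : 'I_n0 -> rel 'I_N.+1) (A : 'I_n0 -> 'M[R]_N.+1).
Hypothesis ht : switching_instants t_.
Hypothesis hsigma : switching_signal t_ sigma.
Hypothesis adjA : forall p, weighted_adjacency (E p) (A p).
Hypothesis conn : exists (i_ : nat -> nat) (eps : R),
    [/\ {homo i_ : k l / (k < l)%N},
        0 < eps,
        forall k, t_ (i_ k.+1) - t_ (i_ k) < eps
      & forall k,
          has_spanning_tree (union_graph E sigma t_ (i_ k) (i_ k.+1)) ord0].
Variables (K : finType) (mu beta lambda : R).
Hypotheses (mu_gt0 : 0 < mu) (beta_ge0 : 0 <= beta) (lambda_gt0 : 0 < lambda).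

(** Boundedness first turns the state-dependent estimate of [d] into pure exponential decay; the
    rate is then applied to each component separately. *)
Lemma perturbed_consensus_exponential (y d : 'I_N.+1 -> K -> R -> R) :
  (forall k (t : R), y ord0 k t = 0) ->
  (forall i k, i != ord0 -> trajectory t_ (y i k)
    (fun t => mu * (\sum_j A (sigma t) i j * (y j k t - y i k t)) + d i k t)) ->
  (forall i k (t m : R), i != ord0 -> 0 <= t ->
    (forall j k', `|y j k' t| <= m) ->
    `|d i k t| <= beta * expR (- lambda * t) * (1 + m)) ->
  exists alpha la : R, [/\ 0 < alpha, 0 < la & forall i k (t : R), 0 <= t ->
    `|y i k t| <= alpha * expR (- la * t)].
Proof.
move=> y0 yt0 dl.
pose a t i j := mu * A (sigma t) i j.
have A_ge0 p i j : 0 <= A p i j by case: (adjA p).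
have a_ge0 t i j : 0 <= a t i j by rewrite mulr_ge0 // ltW.
have yt i k : i != ord0 -> trajectory t_ (y i k)
    (fun t => \sum_j a t i j * (y j k t - y i k t) + d i k t).
  move=> i0; apply: trajectory_eq (yt0 i k i0) _ => l t _.
  by rewrite mulr_sumr; congr (_ + _); apply: eq_bigr => j _; rewrite mulrA.
(* Finitely many modes give one bound for all row sums; adding [1] makes it positive. *)
pose c : R := mu * (\sum_p \sum_i \sum_j A p i j) + 1.
have c_gt0 : 0 < c.
  by rewrite ltr_wpDl // mulr_ge0 ?(ltW mu_gt0) //; do 3!apply: sumr_ge0 => ? _.
have a_le t i : \sum_j a t i j <= c.
  rewrite -mulr_sumr /c -[leLHS]addr0; apply: lerD => //.
  rewrite ler_wpM2l ?(ltW mu_gt0) //.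
  apply: (@le_trans _ _ (\sum_i' \sum_j A (sigma t) i' j)).
    by rewrite [leRHS](bigD1 i) //= lerDl; do 2!apply: sumr_ge0 => ? _.
  by rewrite [leRHS](bigD1 (sigma t)) //= lerDl; do 3!apply: sumr_ge0 => ? _.
(* The least positive weight over the finitely many modes, capped at [1], which is also the value
   when there is no edge. *)
pose amin : R := mu * \big[Order.min/1]_(q : 'I_n0 * 'I_N.+1 * 'I_N.+1
  | 0 < A q.1.1 q.1.2 q.2) A q.1.1 q.1.2 q.2.
have amin_gt0 : 0 < amin.
  rewrite mulr_gt0 //; elim/big_ind : _ => // x z x0 z0.
  by rewrite lt_min x0.
have a_edge l (t : R) i j : t_ l < t < t_ l.+1 -> E (sigma (t_ l)) j i ->
    amin <= a t i j.
  move=> /andP[t1 t2] Eji; rewrite /a (hsigma (i := l)) ?(ltW t1) //.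
  have [_ _ Apos] := adjA (sigma (t_ l)).
  rewrite /amin ler_wpM2l ?(ltW mu_gt0) //.
  apply: (@bigmin_le_cond _ _ _ 1 (sigma (t_ l), i, j)
    (fun q => 0 < A q.1.1 q.1.2 q.2) (fun q => A q.1.1 q.1.2 q.2)).
  exact/Apos.
have [i_ [eps [i_homo eps0 wlt wtree]]] := conn.
have [_ [tau [tau0 dwell]]] := ht.
have wedge k (P : {set 'I_N.+1}) : ord0 \in P -> (#|P| < N.+1)%N ->
    exists l j i, [/\ (i_ k <= l < i_ k.+1)%N, j \in P, i \notin P
      & E (sigma (t_ l)) j i].
  move=> P0 ltP.
  have [|j [i [jP iP /hasP[l]]]] := spanning_tree_crossing (wtree k) P0.
    by rewrite card_ord.
  by rewrite mem_index_iota => lk Eji; exists l, j, i.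
have [la la0 rate] := consensus_rate ht c_gt0 amin_gt0 tau0 eps0 lambda_gt0
  a_ge0 a_le a_edge dwell i_homo wlt wedge.
have [B yB] := consensus_bounded ht beta_ge0 lambda_gt0 a_ge0 y0 yt dl.
pose B' := `|B| + 1.
have B'0 : 0 <= B' by exact: addr_ge0.
have /choice[al alP] : forall k, exists alpha : R, forall i (t : R), 0 <= t ->
    `|y i k t| <= alpha * expR (- la * t).
  move=> k; apply: (rate (fun i => y i k) (fun i => d i k) (beta * B')) => //.
  - exact: mulr_ge0.
  - by move=> i i0; exact: yt.
  - move=> i t i0 t0; apply: le_trans (dl i k t `|B| i0 t0 _) _.
      by move=> j k'; apply: le_trans (yB j k' t t0) (ler_norm _).
    by rewrite /B' mulrAC [1 + _]addrC.
exists (\sum_k `|al k| + 1), la; split=> //.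
  by rewrite ltr_wpDl // sumr_ge0.
move=> i k t t0; apply: le_trans (alP k i t t0) _.
rewrite ler_wpM2r ?expR_ge0 // (bigD1 k) //= -addrA.
apply: le_trans (ler_norm _) _; rewrite lerDl addr_ge0 // sumr_ge0 //.
Qed.

End PerturbedConsensus.

(** * Rotating modal coordinates *)

Section ComplexParts.
Variable R : rcfType.

Lemma Re_mulc (x y : R[i]) :
  complex.Re (x * y) = complex.Re x * complex.Re y - complex.Im x * complex.Im y.
Proof. by case: x y => [a b] [a' b']. Qed.

Lemma Im_mulc (x y : R[i]) :
  complex.Im (x * y) = complex.Re x * complex.Im y + complex.Im x * complex.Re y.
Proof. by case: x y => [a b] [a' b']. Qed.

Lemma Re_mulmx m n p (X : 'M[R[i]]_(m, n)) (Y : 'M[R[i]]_(n, p)) :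
  map_mx (@complex.Re R) (X *m Y) =
  map_mx (@complex.Re R) X *m map_mx (@complex.Re R) Y
  - map_mx (@complex.Im R) X *m map_mx (@complex.Im R) Y.
Proof.
apply/matrixP => i j; rewrite !mxE raddf_sum -sumrB; apply: eq_bigr => k _.
by rewrite !mxE -Re_mulc.
Qed.

Lemma Im_mulmx m n p (X : 'M[R[i]]_(m, n)) (Y : 'M[R[i]]_(n, p)) :
  map_mx (@complex.Im R) (X *m Y) =
  map_mx (@complex.Re R) X *m map_mx (@complex.Im R) Y
  + map_mx (@complex.Im R) X *m map_mx (@complex.Re R) Y.
Proof.
apply/matrixP => i j; rewrite !mxE raddf_sum -big_split /=; apply: eq_bigr => k _.
by rewrite !mxE -Im_mulc.
Qed.

End ComplexParts.

(* [A + i B] has left eigenvectors of [S] as rows, with eigenvalues [i w_k], and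
   [G - i H] is its inverse. *)
Lemma real_modal_form (R : realType) (q : nat) (S : 'M[R]_q) :
  distinct_imaginary_eigenvalues S ->
  exists (A B G H : 'M[R]_q) (w : 'rV[R]_q),
    [/\ A *m S = - (diag_mx w *m B), B *m S = diag_mx w *m A
      & G *m A + H *m B = 1%:M].
Proof.
case=> lambda [charS ul Rel].
case: q S charS => [|q] S charS.
  by exists 0, 0, 0, 0, 0; split; rewrite [LHS]flatmx0 [RHS]flatmx0.
pose SC := map_mx (real_complex R) S.
(* The minimal polynomial divides the characteristic polynomial, whose roots are distinct. *)
have [P Pu /diagonalizable_forPex[d /(simmxPp (stablemx_unit _ Pu)) PS]] : diagonalizable SC.
  apply/diagonalizableP; exists lambda => //.
  by rewrite -charS mxminpoly_dvd_char.
(* Row [k] of [P] is a nonzero left eigenvector, so [d 0 k] is one of the listed eigenvalues. *)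
have d_re k : complex.Re (d 0 k) = 0.
  apply: Rel; rewrite -root_prod_XsubC -charS -eigenvalue_root_char.
  apply/eigenvalueP; exists (row k P).
    by rewrite -row_mul PS; apply/rowP => j; rewrite mul_diag_mx !mxE.
  apply/eqP => r0; have : delta_mx 0 k *m P *m invmx P = 0 :> 'rV_q.+1.
    by rewrite -rowE r0 mul0mx.
  rewrite mulmxK // => /matrixP/(_ 0 k); rewrite !mxE !eqxx => /eqP.
  by rewrite oner_eq0.
have reS : map_mx (@complex.Re R) SC = S by apply/matrixP => i j; rewrite !mxE.
have imS : map_mx (@complex.Im R) SC = 0 by apply/matrixP => i j; rewrite !mxE.
have reD : map_mx (@complex.Re R) (diag_mx d) = 0.
  by apply/matrixP => i j; rewrite !mxE raddfMn /= d_re mul0rn.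
have imD : map_mx (@complex.Im R) (diag_mx d) = diag_mx (map_mx (@complex.Im R) d).
  by apply/matrixP => i j; rewrite !mxE raddfMn.
exists (map_mx (@complex.Re R) P), (map_mx (@complex.Im R) P),
  (map_mx (@complex.Re R) (invmx P)), (- map_mx (@complex.Im R) (invmx P)),
  (map_mx (@complex.Im R) d); split.
- have := congr1 (map_mx (@complex.Re R)) PS; rewrite !Re_mulmx reS imS reD imD.
  by rewrite mulmx0 subr0 mul0mx sub0r.
- have := congr1 (map_mx (@complex.Im R)) PS; rewrite !Im_mulmx reS imS reD imD.
  by rewrite mulmx0 add0r mul0mx add0r.
- rewrite mulNmx -Re_mulmx mulVmx //.
  by apply/matrixP => i j; rewrite !mxE raddfMn.
Qed.

(** * Entrywise norm estimates *)

Section MatrixNorm.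
Variable R : realType.

Lemma mx_norm_le m n (M : 'M[R]_(m, n)) (c : R) : 0 <= c ->
  (forall i j, `|M i j| <= c) -> `|M| <= c.
Proof.
by move=> c0 Mc; rewrite [leLHS]/Num.norm /= mx_normrE; apply: bigmax_le => // -[i j] _.
Qed.

Lemma mx_entry_le_norm m n (M : 'M[R]_(m, n)) i j : `|M i j| <= `|M|.
Proof.
rewrite [leRHS]/Num.norm /= mx_normrE.
exact: (@le_bigmax _ _ _ _ (fun ij : 'I_m * 'I_n => `|M ij.1 ij.2|) (i, j)).
Qed.

Lemma mulmx_norm_le m n p (X : 'M[R]_(m, n)) (Y : 'M[R]_(n, p)) :
  `|X *m Y| <= n%:R * (`|X| * `|Y|).
Proof.
apply: mx_norm_le => [|i j]; first by rewrite !mulr_ge0.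
rewrite mxE; apply: le_trans (ler_norm_sum _ _ _) _.
have -> : n%:R * (`|X| * `|Y|) = \sum_(k < n) `|X| * `|Y|.
  by rewrite sumr_const card_ord mulr_natl.
by apply: ler_sum => k _; rewrite normrM ler_pM // mx_entry_le_norm.
Qed.

End MatrixNorm.

Section ModalCoordinates.
Variables (R : realType) (t_ : nat -> R) (q : nat) (A B : 'M[R]_q) (w : 'rV[R]_q).

(** Row [k] holds the real part ([false]) or imaginary part ([true]) of [exp (- i w_k t)] times row
    [k] of [A + i B]. *)
Definition modal (b : bool) (t : R) : 'M[R]_q := \matrix_(k, m)
  if b then cos (w 0 k * t) * B k m - sin (w 0 k * t) * A k m
  else cos (w 0 k * t) * A k m + sin (w 0 k * t) * B k m.

Lemma modal_norm_le b t : `|modal b t| <= `|A| + `|B|.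
Proof.
apply: mx_norm_le => [|k m]; first exact: addr_ge0.
have trig_le c x M : `|c| <= 1 -> `|x| <= M -> `|c * x| <= M :> R.
  by move=> c1 xM; rewrite normrM -[leRHS]mul1r ler_pM.
have sin_le1 x : `|sin x| <= 1 :> R by rewrite ler_norml sin_geN1 sin_le1.
have cos_le1 x : `|cos x| <= 1 :> R by rewrite ler_norml cos_geN1 cos_le1.
rewrite mxE; case: b.
  rewrite [leRHS]addrC; apply: le_trans (ler_normB _ _) _.
  by apply: lerD; apply: trig_le => //; exact: mx_entry_le_norm.
apply: le_trans (ler_normD _ _) _.
by apply: lerD; apply: trig_le => //; exact: mx_entry_le_norm.
Qed.

Lemma modal_inverse_l t :
  A = \matrix_(k, m) (cos (w 0 k * t) * modal false t k m
                      - sin (w 0 k * t) * modal true t k m).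
Proof.
apply/matrixP => k m; rewrite !mxE.
set c := cos _; set s := sin _; have cs : c ^+ 2 + s ^+ 2 = 1 := cos2Dsin2 _.
transitivity ((c ^+ 2 + s ^+ 2) * A k m); first by rewrite cs mul1r.
by ring.
Qed.

Lemma modal_inverse_r t :
  B = \matrix_(k, m) (sin (w 0 k * t) * modal false t k m
                      + cos (w 0 k * t) * modal true t k m).
Proof.
apply/matrixP => k m; rewrite !mxE.
set c := cos _; set s := sin _; have cs : c ^+ 2 + s ^+ 2 = 1 := cos2Dsin2 _.
transitivity ((c ^+ 2 + s ^+ 2) * B k m); first by rewrite cs mul1r.
by ring.
Qed.

(** Rotating back recovers [A *m x] and [B *m x], each within [2 * c], and then [x = G A x + H B x];
    the constant does not depend on [t]. *)
Lemma modal_bound (G H : 'M[R]_q) : G *m A + H *m B = 1%:M ->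
  exists2 C : R, 0 <= C & forall (x : 'cV[R]_q) (t c : R), 0 <= c ->
    (forall b k, `|(modal b t *m x) k 0| <= c) -> `|x| <= C * c.
Proof.
move=> GH; exists (q%:R * (`|G| * 2) + q%:R * (`|H| * 2)).
  by rewrite addr_ge0 // !mulr_ge0.
move=> x t c c0 xc.
have trig_le s y : `|s| <= 1 -> `|y| <= c -> `|s * y| <= c :> R.
  by move=> s1 yc; rewrite normrM -[leRHS]mul1r ler_pM.
have sin_le1 y : `|sin y| <= 1 :> R by rewrite ler_norml sin_geN1 sin_le1.
have cos_le1 y : `|cos y| <= 1 :> R by rewrite ler_norml cos_geN1 cos_le1.
have Ax : `|A *m x| <= 2 * c.
  apply: mx_norm_le => [|k j]; first exact: mulr_ge0.
  have -> : (A *m x) k j = cos (w 0 k * t) * (modal false t *m x) k 0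
      - sin (w 0 k * t) * (modal true t *m x) k 0.
    rewrite {1}(modal_inverse_l t) [j]ord1 [LHS]mxE [(modal false t *m x) k 0]mxE.
    rewrite [(modal true t *m x) k 0]mxE !mulr_sumr -sumrB.
    by apply: eq_bigr => m _; rewrite [(\matrix_(_, _) _) k m]mxE mulrBl !mulrA.
  apply: le_trans (ler_normB _ _) _.
  by have := trig_le _ _ (cos_le1 (w 0 k * t)) (xc false k);
     have := trig_le _ _ (sin_le1 (w 0 k * t)) (xc true k); lra.
have Bx : `|B *m x| <= 2 * c.
  apply: mx_norm_le => [|k j]; first exact: mulr_ge0.
  have -> : (B *m x) k j = sin (w 0 k * t) * (modal false t *m x) k 0
      + cos (w 0 k * t) * (modal true t *m x) k 0.
    rewrite {1}(modal_inverse_r t) [j]ord1 [LHS]mxE [(modal false t *m x) k 0]mxE.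
    rewrite [(modal true t *m x) k 0]mxE !mulr_sumr -big_split.
    by apply: eq_bigr => m _; rewrite [(\matrix_(_, _) _) k m]mxE mulrDl !mulrA.
  apply: le_trans (ler_normD _ _) _.
  by have := trig_le _ _ (sin_le1 (w 0 k * t)) (xc false k);
     have := trig_le _ _ (cos_le1 (w 0 k * t)) (xc true k); lra.
have -> : x = G *m (A *m x) + H *m (B *m x) by rewrite !mulmxA -mulmxDl GH mul1mx.
apply: le_trans (ler_normD _ _) _; rewrite mulrDl -!mulrA.
by apply: lerD; apply: le_trans (mulmx_norm_le _ _) _; rewrite !ler_wpM2l.
Qed.

Variable S : 'M[R]_q.
Hypotheses (AS : A *m S = - (diag_mx w *m B)) (BS : B *m S = diag_mx w *m A).

Definition modal_derivative b t : 'M[R]_q := - (modal b t *m S).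

(** Differentiating [exp (- i w t) P] brings out [- i w], and [i w P = P S] for the left
    eigenvectors. *)
Lemma modal_trajectory b k m :
  trajectory t_ (fun t => modal b t k m) (fun t => modal_derivative b t k m).
Proof.
have ASkm : (A *m S) k m = - (w 0 k * B k m) by rewrite AS mul_diag_mx !mxE.
have BSkm : (B *m S) k m = w 0 k * A k m by rewrite BS mul_diag_mx !mxE.
have tc c : trajectory t_ (fun t => cos (w 0 k * t) * c)
    (fun t => - (w 0 k * sin (w 0 k * t)) * c).
  apply: trajectory_eq (trajectoryM (trajectory_cos _ _) (trajectory_cst _ c)) _.
  by move=> l t _; ring.
have ts c : trajectory t_ (fun t => sin (w 0 k * t) * c)
    (fun t => w 0 k * cos (w 0 k * t) * c).
  apply: trajectory_eq (trajectoryM (trajectory_sin _ _) (trajectory_cst _ c)) _.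
  by move=> l t _; ring.
case: b; under eq_fun do rewrite mxE.
  apply: trajectory_eq (trajectoryB (tc _) (ts _)) _ => l t _.
  rewrite /modal_derivative [RHS]mxE.
  have -> : (modal true t *m S) k m =
      cos (w 0 k * t) * (B *m S) k m - sin (w 0 k * t) * (A *m S) k m.
    rewrite [LHS]mxE [(B *m S) k m]mxE [(A *m S) k m]mxE !mulr_sumr -sumrB.
    by apply: eq_bigr => j _; rewrite mxE mulrBl !mulrA.
  by rewrite ASkm BSkm; ring.
apply: trajectory_eq (trajectoryD (tc _) (ts _)) _ => l t _.
rewrite /modal_derivative [RHS]mxE.
have -> : (modal false t *m S) k m =
    cos (w 0 k * t) * (A *m S) k m + sin (w 0 k * t) * (B *m S) k m.
  rewrite [LHS]mxE [(A *m S) k m]mxE [(B *m S) k m]mxE !mulr_sumr -big_split.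
  by apply: eq_bigr => j _; rewrite mxE mulrDl !mulrA.
by rewrite ASkm BSkm; ring.
Qed.

(* In the rotating modal frame the drift [S x] disappears. *)
Lemma modal_coordinate_trajectory (x g : R -> 'cV[R]_q) b k :
  (forall m, trajectory t_ (fun t => x t m 0) (fun t => (S *m x t + g t) m 0)) ->
  trajectory t_ (fun t => (modal b t *m x t) k 0) (fun t => (modal b t *m g t) k 0).
Proof.
move=> xt; under eq_fun do rewrite mxE.
apply: trajectory_eq (trajectory_sum (fun m => trajectoryM (modal_trajectory b k m) (xt m))) _.
move=> l t _; rewrite big_split /=.
transitivity ((modal_derivative b t *m x t + modal b t *m (S *m x t + g t)) k 0).
  by rewrite [RHS]mxE; congr (_ + _); rewrite [RHS]mxE.
by rewrite /modal_derivative mulNmx mulmxDr mulmxA addKr.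
Qed.

End ModalCoordinates.

(** * The observer *)

(** At an interior point of a dwell interval small increments stay inside it, so the relative
    derivative is the two-sided one. *)
Lemma solution_entry_trajectory (R : realType) (t_ : nat -> R) m n
    (x f : R -> 'M[R]_(m, n)) i j :
  piecewise_solution t_ x f ->
  trajectory t_ (fun t => x t i j) (fun t => f t i j).
Proof.
move=> [xc xd]; split=> [z|l t /andP[lt tl]].
  exact: cvg_comp _ _ (xc z) (@coord_continuous _ _ _ i j (x z)).
have ltl : t_ l <= t < t_ l.+1 by rewrite ltW.
have D : h^-1 *: (x (h *: 1 + t) i j - x t i j) @[h --> 0^'] --> f t i j.
  have cx := cvg_comp _ _ (xd l t ltl) (@coord_continuous _ _ _ i j (f t)).
  move=> U nU; have HU : \forall s \near t, s != t -> `[t_ l, t_ l.+1[%classic s ->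
    U (((s - t)^-1 *: (x s - x t)) i j) := cx U nU.
  move/nbhs0P : HU => HU; apply: filter_app HU; near=> h.
  rewrite /= [h *: 1]mulr1 [h + t]addrC addrAC subrr add0r !mxE => HU h0.
  apply: HU; first by rewrite -subr_eq0 addrAC subrr add0r.
  rewrite /= in_itv /=; apply/andP; split; first apply: ltW.
    by rewrite -ltrBlDl; near: h; apply: lt_nbhsr; rewrite subr_lt0.
  by rewrite -ltrBrDl; near: h; apply: lt_nbhsl; rewrite subr_gt0.
split; first by apply/cvg_ex; exists (f t i j).
exact: cvg_lim D.
Unshelve. all: by end_near. Qed.

Lemma mxcol_converges_exponentially (R : realType) (N m n : nat)
    (X : 'I_N -> R -> 'M[R]_(m, n)) (alpha lambda : R) :
  0 < alpha -> 0 < lambda ->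
  (forall i t, 0 <= t -> `|X i t| <= alpha * expR (- lambda * t)) ->
  converges_to0_exponentially (fun t => \mxcol_(i < N) X i t).
Proof.
move=> a0 l0 Xle; exists alpha, lambda; split=> // t t0.
apply: mx_norm_le => [|i j]; first by rewrite mulr_ge0 ?expR_ge0 ?ltW.
by rewrite mxE; apply: le_trans (mx_entry_le_norm _ _ _) (Xle _ _ t0).
Qed.

Theorem lemma3p1 (R : realType) (r nw N n0 : nat)
  (Sa : 'M[R]_r) (Sb : 'M[R]_nw) (S : 'M[R]_(r + nw))
  (defS : S = block_mx Sa 0 0 Sb)
  (eigS : distinct_imaginary_eigenvalues S)
  (t_ : nat -> R) (t_switch : switching_instants t_)
  (sigma : R -> 'I_n0) (sigma_switch : switching_signal t_ sigma)
  (E : 'I_n0 -> rel 'I_N.+1) (A : 'I_n0 -> 'M[R]_N.+1)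
  (adjA : forall p, weighted_adjacency (E p) (A p))
  (conn : exists (i_ : nat -> nat) (eps : R),
    [/\ {homo i_ : k l / (k < l)%N},
        0 < eps,
        forall k, t_ (i_ k.+1) - t_ (i_ k) < eps
      & forall k,
          has_spanning_tree (union_graph E sigma t_ (i_ k) (i_ k.+1)) ord0])
  (mu1 mu2 : R) (mu1_gt0 : 0 < mu1) (mu2_gt0 : 0 < mu2)
  (v : R -> 'cV[R]_(r + nw))
  (leader : piecewise_solution t_ v (fun t => S *m v t))
  (Shat : 'I_N.+1 -> R -> 'M[R]_(r + nw))
  (vhat : 'I_N.+1 -> R -> 'cV[R]_(r + nw))
  (Shat0 : forall t : R, 0 <= t -> Shat ord0 t = S)
  (vhat0 : forall t : R, 0 <= t -> vhat ord0 t = v t)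
  (Shat_ode : forall i, i != ord0 ->
    piecewise_solution t_ (Shat i)
      (fun t => mu1 *: \sum_(j < N.+1)
                  A (sigma t) i j *: (Shat j t - Shat i t)))
  (vhat_ode : forall i, i != ord0 ->
    piecewise_solution t_ (vhat i)
      (fun t => Shat i t *m vhat i t
                + mu2 *: \sum_(j < N.+1)
                    A (sigma t) i j *: (vhat j t - vhat i t))) :
  converges_to0_exponentially
    (fun t => \mxcol_(i < N) (Shat (lift ord0 i) t - S)) /\
  converges_to0_exponentially
    (fun t => \mxcol_(i < N) (vhat (lift ord0 i) t - v t)).
Proof.
have t_ge0 l (t : R) : t_ l < t < t_ l.+1 -> 0 <= t.
  by case/andP=> lt _; apply/ltW/(le_lt_trans (instants_ge0 t_switch l)).
have [aS [lS [aS0 lS0 St_le]]] : exists alpha la : R, [/\ 0 < alpha, 0 < la &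
    forall i (t : R), 0 <= t -> `|Shat i t - S| <= alpha * expR (- la * t)].
  (* Setting the leader's error to [0] by cases makes it vanish at all real times, while [Shat0]
     speaks only of [t >= 0]. *)
  pose y i (k : 'I_(r + nw) * 'I_(r + nw)) t :=
    if i == ord0 then 0 else Shat i t k.1 k.2 - S k.1 k.2.
  have yE i k (t : R) : 0 <= t -> y i k t = Shat i t k.1 k.2 - S k.1 k.2.
    by move=> t0; rewrite /y; case: eqP => // ->; rewrite Shat0 ?subrr.
  have [|||al [la [al0 la0 yle]]] := perturbed_consensus_exponential
    t_switch sigma_switch adjA conn mu1_gt0 (lexx 0) ltr01 (y := y) (d := fun _ _ _ => 0).
  - by move=> k t; rewrite /y eqxx.
  - move=> i k i0.
    have -> : y i k = fun t => Shat i t k.1 k.2 - S k.1 k.2.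
      by apply/funext => t; rewrite /y (negPf i0).
    apply: trajectory_eq (trajectoryB (solution_entry_trajectory k.1 k.2 (Shat_ode i i0))
      (trajectory_cst _ _)) _ => l t /t_ge0 t0.
    rewrite subr0 addr0 mxE summxE; congr (_ * _); apply: eq_bigr => j _.
    rewrite (yE j) // !mxE; ring.
  - by move=> i k t m _ _ _; rewrite normr0 !mul0r.
  exists al, la; split=> // i t t0; apply: mx_norm_le => [|k1 k2].
    by rewrite mulr_ge0 ?expR_ge0 ?ltW.
  by have := yle i (k1, k2) t t0; rewrite yE // !mxE.
split.
  apply: mxcol_converges_exponentially aS0 lS0 _ => i t; exact: St_le.
have subE (X Y : 'cV[R]_(r + nw)) m : (X - Y) m 0 = X m 0 - Y m 0.
  by rewrite !mxE.
have [MA [MB [MG [MH [w [MAS MBS MGH]]]]]] := real_modal_form eigS.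
have [C C0 modal_le] := modal_bound w MGH.
pose U (b : bool) (t : R) := modal MA MB w b t.
pose CU : R := `|MA| + `|MB|.
have CU0 : 0 <= CU by exact: addr_ge0.
have Umul b t k (x : 'cV[R]_(r + nw)) : `|(U b t *m x) k 0| <= (r + nw)%:R * (CU * `|x|).
  apply: le_trans (mx_entry_le_norm _ _ _) _; apply: le_trans (mulmx_norm_le _ _) _.
  by rewrite ler_wpM2l // ler_wpM2r // modal_norm_le.
have vt b k : trajectory t_ (fun t => (U b t *m v t) k 0) (fun=> 0).
  have := @modal_coordinate_trajectory _ t_ _ MA MB w S MAS MBS v (fun=> 0) b k.
  move=> /(_ _)/wrap[m|h].
    by under [X in trajectory _ _ X]eq_fun do rewrite addr0;
      exact: solution_entry_trajectory.
  by apply: trajectory_eq h _ => l t _; rewrite mulmx0 mxE.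
(* The modal coordinates of [v] have zero derivative, so they stay bounded by their initial
   values. *)
have [V V0 v_le] : exists2 V : R, 0 <= V & forall t, 0 <= t -> `|v t| <= V.
  exists (C * ((r + nw)%:R * (CU * `|v 0|))); first by rewrite !mulr_ge0.
  move=> t t0; apply: (modal_le _ t) => [|b k]; first by rewrite !mulr_ge0.
  apply: le_trans (Umul b 0 k (v 0)); apply: abs_le_of_signs => s; rewrite -subr_ge0.
  pose u (_ : unit) t := `|(U b 0 *m v 0) k 0| - (-1) ^+ s * (U b t *m v t) k 0.
  have ut x : trajectory t_ (u x) (fun=> 0 - (-1) ^+ s * 0).
    by apply: trajectoryB; [exact: trajectory_cst|exact: trajectoryZ].
  have := trajectory_nonneg t_switch (L := 0) (l := 0%N) ut; rewrite t_switch.1.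
  move=> /(_ _ _ tt t t0); apply=> [x m t' _ _ _ _|x].
    by rewrite mul0r mulr0 subr0.
  by rewrite /u subr_ge0; apply: le_trans (ler_norm _) _; rewrite normrMsign.
pose y i (p : 'I_(r + nw) * bool) t :=
  if i == ord0 then 0 else (U p.2 t *m (vhat i t - v t)) p.1 0.
have yE i p (t : R) : 0 <= t -> y i p t = (U p.2 t *m (vhat i t - v t)) p.1 0.
  by move=> t0; rewrite /y; case: eqP => // ->; rewrite vhat0 ?subrr ?mulmx0 ?mxE.
pose d i (p : 'I_(r + nw) * bool) t :=
  (U p.2 t *m ((Shat i t - S) *m vhat i t)) p.1 0.
(* Collects the two matrix product estimates, [|Shat i t - S| <= aS * expR (- lS * t)] and [|vhat i
   t| <= C * m + V <= (C + V) * (1 + m)]. *)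
pose beta : R := (r + nw)%:R * (CU * ((r + nw)%:R * (aS * (C + V)))).
have beta0 : 0 <= beta by rewrite !mulr_ge0 ?(ltW aS0) ?addr_ge0.
have err_le i (t m : R) : 0 <= t -> 0 <= m -> (forall p, `|y i p t| <= m) ->
    `|vhat i t - v t| <= C * m.
  move=> t0 m0 ym; apply: (modal_le _ t) => // b k.
  by have := ym (k, b); rewrite yE.
have [|||al [la [al0 la0 yle]]] := perturbed_consensus_exponential
    t_switch sigma_switch adjA conn mu2_gt0 beta0 lS0 (y := y) (d := d).
- by move=> p t; rewrite /y eqxx.
- move=> i p i0.
  have -> : y i p = fun t => (U p.2 t *m (vhat i t - v t)) p.1 0.
    by apply/funext => t; rewrite /y (negPf i0).
  have := @modal_coordinate_trajectory _ t_ _ MA MB w S MAS MBS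
    (fun t => vhat i t - v t) (fun t => (Shat i t - S) *m vhat i t +
      mu2 *: \sum_j A (sigma t) i j *: (vhat j t - vhat i t)) p.2 p.1.
  move=> /(_ _)/wrap[m|h].
    under eq_fun do rewrite subE.
    apply: trajectory_eq (trajectoryB (solution_entry_trajectory m 0 (vhat_ode i i0))
      (solution_entry_trajectory m 0 leader)) _ => l t _.
    set X := mu2 *: _.
    (* Writing [Shat i = S + (Shat i - S)] isolates the drift [S] of the error, which the modal
       frame removes. *)
    have -> : S *m (vhat i t - v t) + ((Shat i t - S) *m vhat i t + X) =
      Shat i t *m vhat i t + X - S *m v t.
      rewrite mulmxBr mulmxBl.
      move: (S *m vhat i t) (S *m v t) (Shat i t *m vhat i t) X => a b c X.
      by apply/colP => j; rewrite !mxE; ring.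
    by rewrite subE.
  apply: trajectory_eq h _ => l t /t_ge0 t0.
  rewrite mulmxDr mxE addrC; congr (_ + _).
  rewrite -scalemxAr mxE mulmx_sumr summxE; congr (_ * _); apply: eq_bigr => j _.
  rewrite !yE // -scalemxAr mxE; congr (_ * _).
  have -> : vhat j t - vhat i t = (vhat j t - v t) - (vhat i t - v t).
    by rewrite opprB addrA subrK.
  by rewrite mulmxBr subE.
- move=> i p t m i0 t0 ym.
  have m0 : 0 <= m := le_trans (normr_ge0 _) (ym i p).
  have e0 := expR_ge0 (- lS * t).
  apply: le_trans (Umul _ _ _ _) _; rewrite /beta -!mulrA ler_wpM2l // ler_wpM2l //.
  apply: le_trans (mulmx_norm_le _ _) _; rewrite ler_wpM2l //.
  have -> : aS * ((C + V) * (expR (- lS * t) * (1 + m))) =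
    aS * expR (- lS * t) * ((C + V) * (1 + m)) by ring.
  apply: ler_pM => //; first exact: St_le.
  rewrite -[vhat i t](subrK (v t)); apply: le_trans (ler_normD _ _) _.
  have := err_le i t m t0 m0 (ym i); have := v_le t t0.
  have : 0 <= V * m by exact: mulr_ge0.
  by lra.
(* [C] may be [0], so [1] is added to keep the constant positive. *)
apply: (mxcol_converges_exponentially (alpha := C * al + 1) (lambda := la)) => //.
  by rewrite ltr_wpDl // mulr_ge0 ?(ltW al0).
move=> i t t0; have e0 := expR_ge0 (- la * t).
apply: le_trans (err_le _ t (al * expR (- la * t)) t0 _ _) _.
- by rewrite mulr_ge0 ?(ltW al0).
- by move=> p; exact: yle.
- by rewrite mulrDl mulrA lerDl mul1r.
Qed.
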